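(* Let $P(X)\in\mathbb{Z}[X]$ be a polynomial. Then the following statements hold: (1) there is a noncommutative ring $R$ for which $P(X)=0$ is an identity if and only if there is a prime $p$ such that $P(X)\in(p,(X^p-X)^2)\mathbb{Z}[X]$; (2) there is a noncommutative ring $R$ for which $P(X)Y=YP(X)$ is an identity if and only if there is a prime $p$ such that the first derivative $P'(X)$ of $P(X)$ is in the ideal $(p,X^p-X)\mathbb{Z}[X]$.
   Context: All rings are associative with an identity element $1$. A noncommutative ring is a ring that is not commutative. ''$P(X)=0$ is an identity for $R$'' means $P(r)=0$ for all $r\in R$; ''$P(X)Y=YP(X)$ is an identity for $R$'' means $P(r)t=tP(r)$ for all $r,t\in R$. *)

(* Defs.v *)
From mathcomp Require Import all_boot all_order all_algebra.

Set Implicit Arguments.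
Unset Strict Implicit.
Unset Printing Implicit Defensive.

Import GRing.Theory.
Local Open Scope ring_scope.

(* [nzRingType] only excludes the zero ring, which is commutative. *)
Definition noncommutative (R : nzRingType) : Prop :=
  ~ commutative (@GRing.mul R).

(* P(r), with the integer coefficients of P sent to their images in R; these
   are central, so the side on which they multiply powers of r is irrelevant. *)
Definition int_eval (R : nzRingType) (P : {poly int}) (r : R) : R :=
  (map_poly intr P).[r].

Definition zero_identity (R : nzRingType) (P : {poly int}) : Prop :=
  forall r : R, int_eval P r = 0.

Definition central_identity (R : nzRingType) (P : {poly int}) : Prop :=
  forall r t : R, int_eval P r * t = t * int_eval P r.

Definition in_ideal2 (A : comNzRingType) (a b x : A) : Prop :=
  exists u v : A, x = u * a + v * b.

(* Main.v *)
(* If [P] is central on a noncommutative ring [R], eliminating the terms of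
   degree at least 2 shows that all commutators are killed by a fixed nonzero
   integer, so some nonzero commutator is killed by a prime [p].  Suppose that
   [p] does not divide [P'(a)]; then [E = P(X + a) - P(a)] is central, has no
   constant term, and has a linear coefficient prime to [p].  Factoring out the
   torsion prime to [p], such an identity forces commutativity:
   - an element whose large powers are central is central, so [p R] is central
     and [p] kills all commutators;
   - the same elimination, with multiplier [E(x)], gives a polynomial nonzero
     mod [p] whose values annihilate all commutators; modulo [p] it divides
     some [(X - X^q)^s], [q] a power of [p], whence [x - x^q] is central;
   - modulo the annihilator of the commutators all elements then satisfy
     [x^(q^p) = x], so that this quotient is commutative by Jacobson's theorem;
   - hence every commutator [c = [x, y]] has square zero and is central, and
     [c = [x^q, y] = q x^(q-1) c = 0].
   So [P'] vanishes on [F_p], and so does [P] if [P = 0] is an identity.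
   Conversely, upper triangular 2x2 matrices over [F_p] satisfy
   [(X^p - X)^2 = 0], and upper triangular 3x3 matrices with constant diagonal
   satisfy [P(a + N) = P(a) + P'(a) N + (central)] for [N] strictly upper. *)

Require Import Defs.
From mathcomp Require Import all_boot all_order all_algebra all_field.
From mathcomp Require boolp classical_sets.
From HB Require Import structures.

Set Implicit Arguments.
Unset Strict Implicit.
Unset Printing Implicit Defensive.

Import GRing.Theory.
Local Open Scope ring_scope.

(** * Quotients by two-sided ideals *)

Section TwoSidedQuotient.

Variables (R : nzRingType) (I : zmodClosed R).
Hypothesis I1 : 1 \notin I.
Hypothesis IMl : forall a u : R, u \in I -> a * u \in I.
Hypothesis IMr : forall a u : R, u \in I -> u * a \in I.

Local Notation Q := (Quotient.quot I).
Local Notation pi := (\pi_Q%qT : R -> Q).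

Let quot_one : Q := pi 1.
Let quot_mul (x y : Q) : Q := pi (generic_quotient.repr x * generic_quotient.repr y).

Let pi_eq (x y : R) : (pi x = pi y) <-> (x - y \in I).
Proof. by rewrite Quotient.idealrBE; split=> [->|/eqP]. Qed.

Let quot_mulE x y : quot_mul (pi x) (pi y) = pi (x * y).
Proof.
apply/pi_eq; set x' := generic_quotient.repr _; set y' := generic_quotient.repr _.
have Ix : x' - x \in I by apply/pi_eq; rewrite generic_quotient.reprK.
have Iy : y' - y \in I by apply/pi_eq; rewrite generic_quotient.reprK.
(* The difference splits as [(x' - x) * y' + x * (y' - y)], one summand for each side of the
   ideal. *)
rewrite -[x' * y'](subrK (x * y')) -mulrBl -addrA -mulrBr.
by apply: rpredD; [apply: IMr | apply: IMl].
Qed.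

Let quot_ind (K : Q -> Prop) : (forall x, K (pi x)) -> forall x, K x.
Proof. by move=> Kpi x; rewrite -[x]generic_quotient.reprK; apply: Kpi. Qed.

Let piD x y : pi (x + y) = pi x + pi y. Proof. exact: raddfD. Qed.

Let quot_mulA : associative quot_mul.
Proof.
elim/quot_ind=> x; elim/quot_ind=> y; elim/quot_ind=> z.
by rewrite !quot_mulE mulrA.
Qed.
Let quot_mul1x : left_id quot_one quot_mul.
Proof. by elim/quot_ind=> x; rewrite quot_mulE mul1r. Qed.
Let quot_mulx1 : right_id quot_one quot_mul.
Proof. by elim/quot_ind=> x; rewrite quot_mulE mulr1. Qed.
Let quot_mulDl : left_distributive quot_mul +%R.
Proof.
elim/quot_ind=> x; elim/quot_ind=> y; elim/quot_ind=> z.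
by rewrite -piD !quot_mulE mulrDl piD.
Qed.
Let quot_mulDr : right_distributive quot_mul +%R.
Proof.
elim/quot_ind=> x; elim/quot_ind=> y; elim/quot_ind=> z.
by rewrite -piD !quot_mulE mulrDr piD.
Qed.
Let quot_one_neq0 : quot_one != 0.
Proof.
apply: contraNneq I1 => e1.
by rewrite -[1]subr0; apply/pi_eq; rewrite raddf0; exact: e1.
Qed.

Definition quot_nzRing : Type := Q.
HB.instance Definition _ := GRing.Zmodule.on quot_nzRing.
HB.instance Definition _ := GRing.Zmodule_isNzRing.Build quot_nzRing
  quot_mulA quot_mul1x quot_mulx1 quot_mulDl quot_mulDr quot_one_neq0.

Definition quot_proj (x : R) : quot_nzRing := pi x.
Let quot_proj_zmod : zmod_morphism quot_proj.
Proof. exact: raddfB. Qed.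
Let quot_proj_monoid : monoid_morphism quot_proj.
Proof. by split=> // x y; rewrite /quot_proj -quot_mulE. Qed.
HB.instance Definition _ :=
  GRing.isZmodMorphism.Build R quot_nzRing quot_proj quot_proj_zmod.
HB.instance Definition _ :=
  GRing.isMonoidMorphism.Build R quot_nzRing quot_proj quot_proj_monoid.

Lemma quot_proj_exists : exists (S : nzRingType) (f : {rmorphism R -> S}),
  (forall s, exists r, s = f r) /\ (forall r, f r = 0 <-> r \in I).
Proof.
exists quot_nzRing, quot_proj; split=> [s | r].
  by exists (generic_quotient.repr (s : Q)); rewrite /= /quot_proj generic_quotient.reprK.
have := pi_eq r 0; rewrite subr0 => <-.
by rewrite (raddf0 pi).
Qed.

End TwoSidedQuotient.

Definition two_sided (R : nzRingType) (I : R -> Prop) :=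
  [/\ I 0, forall x y, I x -> I y -> I (x - y)
    & forall a x, I x -> I (a * x) /\ I (x * a)].

(** Annihilators and Zorn ideals come as [Prop]-valued predicates; [boolp.asbool] makes them
    boolean, as the quotient type demands. *)
Lemma quotient_ring (R : nzRingType) (I : R -> Prop) :
  two_sided I -> ~ I 1 ->
  exists (S : nzRingType) (f : {rmorphism R -> S}),
    (forall s, exists r, s = f r) /\ (forall r, f r = 0 <-> I r).
Proof.
move=> [I0 IB IM] I1.
pose J : {pred R} := fun x => boolp.asbool (I x).
have JP x : x \in J <-> I x by split=> /boolp.asboolP.
have Jz : zmod_closed J by split=> [|x y /JP Ix /JP Iy]; apply/JP; auto.
pose JZ : zmodClosed R := HB.pack J (GRing.isZmodClosed.Build R J Jz).
have [|a u /JP/(IM a)[? _]|a u /JP/(IM a)[_ ?]|S [f [fs fk]]] :=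
  @quot_proj_exists R JZ; [| exact/JP | exact/JP |].
  by apply/negP => /JP.
by exists S, f; split=> // r; rewrite fk JP.
Qed.

(** * Finite subrings *)

Section FiniteSubring.

Variables (R : nzRingType) (s : seq R).
Hypothesis s_closed : subring_closed [in s].

Definition seq_subring : Type := seq_sub s.
HB.instance Definition _ := Finite.on seq_subring.
HB.instance Definition _ := SubChoice.on seq_subring.
HB.instance Definition _ :=
  GRing.SubChoice_isSubNzRing.Build R [in s] seq_subring s_closed.
HB.instance Definition _ := FinRing.isNzRing.Build seq_subring.

(** Wedderburn's little theorem for the finite subring formed by [s]. *)
Lemma finite_domain_comm (x y : R) :
  (forall a b : R, a * b = 0 -> a = 0 \/ b = 0) ->
  x \in s -> y \in s -> x * y = y * x.
Proof.
move=> dom sx sy.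
have domT : GRing.integral_domain_axiom seq_subring.
  move=> a b /(congr1 val); rewrite GRing.valM GRing.val0.
  by case/dom=> ab0; apply/orP; [left | right]; apply/eqP/val_inj; rewrite GRing.val0.
have := @finDomain_mulrC seq_subring domT (SeqSub sx) (SeqSub sy).
by move/(congr1 val); rewrite !GRing.valM.
Qed.

End FiniteSubring.

(** * Finite additive spans in positive characteristic *)

Section AdditiveSpan.

Variables (R : nzRingType) (p : nat).
Hypotheses (p_gt0 : (0 < p)%N) (pR0 : p%:R = 0 :> R).

(** As [p] is zero in [R], coefficients below [p] already give all integer combinations, so the
    generated group is a finite list. *)
Fixpoint add_span (l : seq R) : seq R :=
  if l is m :: l' then [seq m *+ k + s | k <- iota 0 p, s <- add_span l']
  else [:: 0].

Lemma mulrn_modp (x : R) k : x *+ (k %% p) = x *+ k.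
Proof.
by rewrite [in RHS](divn_eq k p) mulrnDr mulnC mulrnA -[x *+ p]mulr_natr pR0 mulr0 mul0rn add0r.
Qed.

Lemma add_span_cons m l k x :
  x \in add_span l -> m *+ k + x \in add_span (m :: l).
Proof.
move=> lx; rewrite -mulrn_modp; apply/allpairsP; exists (k %% p, x)%N.
by rewrite mem_iota ltn_mod.
Qed.

Lemma add_spanP m l x : x \in add_span (m :: l) ->
  exists k y, y \in add_span l /\ x = m *+ k + y.
Proof. by case/allpairsP=> -[k y] /= [_ ly ->]; exists k, y. Qed.

Lemma add_span0 l : 0 \in add_span l.
Proof.
elim: l => [|m l IH]; first exact: mem_head.
by have := add_span_cons m 0 IH; rewrite mulr0n add0r.
Qed.

Lemma add_spanD l x y :
  x \in add_span l -> y \in add_span l -> x + y \in add_span l.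
Proof.
elim: l x y => [|m l IH] x y.
  by rewrite !inE => /eqP-> /eqP->; rewrite addr0.
move=> /add_spanP[k [x' [lx ->]]] /add_spanP[j [y' [ly ->]]].
by rewrite addrACA -mulrnDr add_span_cons ?IH.
Qed.

Lemma mem_add_span l x : x \in l -> x \in add_span l.
Proof.
elim: l => // m l IH; rewrite inE => /predU1P[-> | /IH lx].
  by have := add_span_cons m 1 (add_span0 l); rewrite mulr1n addr0.
by have := add_span_cons m 0 lx; rewrite mulr0n add0r.
Qed.

Lemma add_span_ind (K : R -> Prop) l :
  K 0 -> (forall x y, K x -> K y -> K (x + y)) ->
  (forall x, x \in l -> K x) -> forall x, x \in add_span l -> K x.
Proof.
move=> K0 KD; elim: l => [_ x|m l IH Kl x]; first by rewrite inE => /eqP->.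
move=> /add_spanP[k [y [ly ->]]]; apply: (KD) (IH _ _ ly) => [|z lz].
  elim: k => [|k IHk]; rewrite ?mulr0n // mulrS.
  by apply: (KD) IHk; apply: Kl; rewrite mem_head.
by apply: Kl; rewrite inE lz orbT.
Qed.

Lemma add_spanN l x : x \in add_span l -> - x \in add_span l.
Proof.
have -> : - x = x *+ p.-1.
  by apply/eqP; rewrite eq_sym -addr_eq0 -mulrSr prednK // -mulr_natr pR0 mulr0.
move=> lx; elim: p.-1 => [|n IH]; first by rewrite mulr0n add_span0.
by rewrite mulrS add_spanD.
Qed.

Lemma add_span_subring l :
  1 \in l -> (forall x y, x \in l -> y \in l -> x * y \in add_span l) ->
  subring_closed [in add_span l].
Proof.
move=> l1 lM; split=> [|x y lx ly|x y lx ly]; first exact: mem_add_span.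
  exact/add_spanD/add_spanN.
move: x lx; apply: add_span_ind => [|x x' Kx Kx'|x lx].
- by rewrite mul0r add_span0.
- by rewrite mulrDl add_spanD.
- move: y ly; apply: add_span_ind => [|y y' Ky Ky'|y ly]; last exact: lM.
    by rewrite mulr0 add_span0.
  by rewrite mulrDr add_spanD.
Qed.

Lemma exp_periodic_reduce (x : R) Q n : (1 < Q)%N -> x ^+ Q = x ->
  exists2 i, (i < Q)%N & x ^+ n = x ^+ i.
Proof.
move=> Q1 xQ; have [m] := ubnP n; elim: m n => // m IH n lenm.
have [ltnQ | leQn] := ltnP n Q; first by exists n.
have [|i ltiQ xi] := IH (n - Q).+1; last first.
  by exists i => //; rewrite -xi -{1}(subnK leQn) exprD xQ exprSr.
rewrite ltnS in lenm; apply: leq_trans lenm; rewrite -subSn // ltn_subLR ?(leqW leQn) //.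
by rewrite -(ltn_add2r n) add1n in Q1.
Qed.

(** The relation moves every [b] to the right of every [x], so the monomials [x ^+ i * b ^+ j] with
    [i, j < Q] span a finite subring, and Wedderburn's theorem applies to it. *)
Lemma skew_commute_domain (x b : R) e Q :
  (forall u v : R, u * v = 0 -> u = 0 \/ v = 0) ->
  (1 < Q)%N -> x ^+ Q = x -> b ^+ Q = b -> b * x = x ^+ e * b ->
  x * b = b * x.
Proof.
move=> dom Q1 xQ bQ bx.
have bxn n : b * x ^+ n = x ^+ (e * n) * b.
  elim: n => [|n IH]; first by rewrite muln0 mulr1 mul1r.
  by rewrite exprSr mulrA IH -mulrA bx mulrA -exprD mulnS addnC.
have bnx j n : b ^+ j * x ^+ n = x ^+ (e ^ j * n) * b ^+ j.
  elim: j n => [|j IH] n; first by rewrite mul1n mulr1 mul1r.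
  by rewrite exprSr -mulrA bxn mulrA IH -mulrA -exprSr expnSr mulnA.
pose l := [seq x ^+ i * b ^+ j | i <- iota 0 Q, j <- iota 0 Q].
have lP i j : x ^+ i * b ^+ j \in l.
  have [i' ltiQ ->] := exp_periodic_reduce i Q1 xQ.
  have [j' ltjQ ->] := exp_periodic_reduce j Q1 bQ.
  by apply/allpairsP; exists (i', j'); rewrite !mem_iota.
have l1 : 1 \in l by have := lP 0%N 0%N; rewrite mulr1.
have lx : x \in l by have := lP 1%N 0%N; rewrite mulr1.
have lb : b \in l by have := lP 0%N 1%N; rewrite mul1r.
apply: (@finite_domain_comm R (add_span l)) => //; try exact: mem_add_span.
apply: add_span_subring => // u v.
move=> /allpairsP[[i j] /= [_ _ ->]] /allpairsP[[i' j'] /= [_ _ ->]]; apply: mem_add_span.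
by rewrite -mulrA [b ^+ j * _]mulrA bnx !mulrA -exprD -mulrA -exprD.
Qed.

End AdditiveSpan.

(** * Jacobson's theorem for x^Q = x, with Q divisible by the characteristic *)

Section DivisionRing.

Variables (D : nzRingType) (p Q : nat).
Hypotheses (pD0 : p%:R = 0 :> D) (p_gt0 : (0 < p)%N) (Q_gt1 : (1 < Q)%N).
Hypotheses (pQ : (p %| Q)%N) (D_unit : forall x : D, x != 0 -> x ^+ Q.-1 = 1).

Let D_domain (u v : D) : u * v = 0 -> u = 0 \/ v = 0.
Proof.
move=> uv0; have [-> | u0] := eqVneq u 0; [by left | right].
rewrite -[v]mul1r -(D_unit u0) -(prednK (n := Q.-1)) ?exprSr -?mulrA ?uv0 ?mulr0 //.
by case: Q Q_gt1 => [|[|]].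
Qed.

Let D_period (x : D) : x ^+ Q = x.
Proof.
have Q0 : (0 < Q)%N by apply: ltnW.
have [-> | x0] := eqVneq x 0; first by rewrite expr0n gtn_eqF.
by rewrite -(prednK Q0) exprS D_unit ?mulr1.
Qed.

(* The [b i] are the Fourier components of [y] for conjugation by [x], an
   automorphism of order dividing the order [N] of [x]: they satisfy
   [x (b i) x^-1 = x^i (b i)] and they sum to [N y]. *)
Lemma periodic_division_comm : commutative (@GRing.mul D).
Proof.
move=> x y; apply/eqP; case: eqP => // /eqP xy.
have x0 : x != 0 by apply: contraNneq xy => ->; rewrite mul0r mulr0.
have Q1_gt0 : (0 < Q.-1)%N by case: Q Q_gt1 => [|[|]].
have [N primN dvN] := prim_order_exists Q1_gt0 (D_unit x0).
have N_gt0 := prim_order_gt0 primN; have xN := prim_expr_order primN.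
(* [N] divides [Q - 1], which is [-1] in [D] because [p] divides [Q]. *)
have N_reg : N%:R != 0 :> D.
  apply/negP => /eqP N0; case/dvdnP: dvN => t Qt; case/dvdnP: pQ => t' Qt'.
  have : Q%:R = 0 :> D by rewrite Qt' natrM pD0 mulr0.
  rewrite -(prednK (ltnW Q_gt1)) -natr1 Qt natrM N0 mulr0 add0r => /eqP.
  by rewrite oner_eq0.
pose x' := x ^+ N.-1.
have xx' : x * x' = 1 by rewrite -exprS prednK.
have x'x : x' * x = 1 by rewrite -exprSr prednK.
have cxx' : GRing.comm x x' by rewrite /GRing.comm xx' x'x.
have x'N : x' ^+ N = 1 by rewrite -exprM mulnC exprM xN expr1n.
pose f i j := x' ^+ (i * j) * (x ^+ j * y * x' ^+ j).
pose b i := \sum_(j < N) f i j.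
have bx i : x * b i = x ^+ i * b i * x.
  have fS j : x * f i j * x' = x ^+ i * f i j.+1.
    rewrite /f mulnS exprD !mulrA -exprMn_comm // xx' expr1n mul1r.
    rewrite (commrX (i * j) cxx') -!mulrA -exprSr; congr (_ * _).
    by rewrite !mulrA -exprS.
  have fN : f i N = f i 0%N.
    by rewrite /f muln0 mulnC exprM x'N expr1n xN.
  suff e : x * b i * x' = x ^+ i * b i by rewrite -e -!mulrA x'x mulr1.
  rewrite /b !mulr_sumr mulr_suml (eq_bigr (fun j : 'I_N => x ^+ i * f i j.+1)) //.
  rewrite -!mulr_sumr; congr (_ * _).
  (* Splitting off the first or the last term of one sum shows that the cyclic shift of [j]
     preserves the sum over a period. *)
  have : \sum_(j < N.+1) f i j = \sum_(j < N.+1) f i j by [].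
  rewrite [LHS]big_ord_recl [RHS]big_ord_recr /= fN [RHS]addrC.
  by move/addrI=> ->.
have sum0 : \sum_(i < N) f i 0%N = N%:R * y.
  rewrite (eq_bigr (fun=> y)) => [|i _]; last by rewrite /f muln0 !expr0 !mul1r mulr1.
  by rewrite sumr_const card_ord mulr_natl.
(* For [j] nonzero, [x' ^+ j] is an [N]-th root of unity other than 1, so its geometric sum vanishes
   in a domain. *)
have sumj (j : 'I_N) : j != Ordinal N_gt0 -> \sum_(i < N) f i j = 0.
  move=> j0.
  rewrite (eq_bigr (fun i : 'I_N => (x' ^+ j) ^+ i * (x ^+ j * y * x' ^+ j))); last first.
    by move=> i _; rewrite /f mulnC exprM.
  rewrite -mulr_suml.
  have : (x' ^+ j - 1) * (\sum_(i < N) (x' ^+ j) ^+ i) = 0.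
    by rewrite -subrX1 -exprM mulnC exprM x'N expr1n subrr.
  case/D_domain=> [w1 | ->]; last by rewrite mul0r.
  case/negP: j0; rewrite -val_eqE /=.
  have : x ^+ j == 1.
    move/eqP: w1; rewrite subr_eq0 => /eqP w1.
    by rewrite -[x ^+ j]mulr1 -{1}w1 -exprMn_comm // xx' expr1n.
  rewrite -(prim_order_dvd primN) => /dvdnP[t jt].
  by move: (ltn_ord j); rewrite jt; case: t {jt} => // t; rewrite mulSn ltnNge leq_addr.
have sum_b : \sum_(i < N) b i = N%:R * y.
  rewrite exchange_big /= (bigD1 (Ordinal N_gt0)) //= sum0.
  by rewrite [X in _ + X]big1 ?addr0.
(* If only [b 0] survives, [N%:R * y] equals [b 0], which commutes with [x], and [N] cancels.
   Otherwise a nonzero [b i] with [i > 0] leads to a contradiction. *)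
have [/forallP b0 | ] := boolP [forall i : 'I_N, (0 < i)%N ==> (b i == 0)].
  have : x * (N%:R * y) = (N%:R * y) * x.
    rewrite -sum_b (bigD1 (Ordinal N_gt0)) //= big1 => [|i i0].
      by rewrite addr0 bx mul1r.
    by apply/eqP/(implyP (b0 i)); rewrite lt0n -val_eqE in i0 *.
  rewrite mulrA commr_nat -!mulrA => /eqP; rewrite -subr_eq0 -mulrBr => /eqP.
  by case/D_domain => [/eqP | /eqP]; rewrite ?(negPf N_reg) // subr_eq0 (negPf xy).
rewrite negb_forall => /existsP[i]; rewrite negb_imply => /andP[i_gt0 bi0].
have bix : b i * x = x ^+ (N - i).+1 * b i.
  by rewrite exprSr -mulrA bx !mulrA -exprD subnK ?xN ?mul1r // ltnW.
(* Once [b i] commutes with [x], cancelling it gives [x ^+ (N - i) = 1] with [0 < N - i < N],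
   against the order of [x]. *)
have := skew_commute_domain p_gt0 pD0 D_domain Q_gt1 (D_period x) (D_period (b i)) bix.
rewrite bix => /eqP; rewrite -subr_eq0 -mulrBl => /eqP.
case/D_domain => [| /eqP]; last by rewrite (negPf bi0).
rewrite exprS -[X in X - _]mulr1 -mulrBr => /D_domain[/eqP | /eqP].
  by rewrite (negPf x0).
rewrite subr_eq0 eq_sym -(prim_order_dvd primN) => /dvdn_leq.
by rewrite subn_gt0 ltn_ord leqNgt ltn_subrL i_gt0 N_gt0 => /(_ isT).
Qed.

End DivisionRing.

(** * Reduction of Jacobson's theorem to division rings *)

Lemma maximal_ideal_avoiding (S : nzRingType) (c : S) : c != 0 ->
  exists A : S -> Prop, [/\ two_sided A, ~ A c
    & forall B, two_sided B -> (forall x, A x -> B x) -> ~ B c ->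
      forall x, B x -> A x].
Proof.
move=> c0.
(* Zorn's lemma also tests the empty chain, whose union is empty, so [A 0] cannot be demanded here.
   It is recovered from maximality: an empty [A] would be enlarged by the zero ideal. *)
pose P (A : S -> Prop) := [/\ forall x y, A x -> A y -> A (x - y),
  forall a x, A x -> A (a * x) /\ A (x * a) & ~ A c].
have [F FP Ftot | A [[AB AM Ac] Amax]] := @classical_sets.Zorn_bigcup S P.
  split=> [x y [X FX Xx] [Y FY Yy] | a x [X FX Xx] | [X FX Xc]].
  - have [XY | YX] := Ftot _ _ FX FY.
      by exists Y => //; have [YB _ _] := FP _ FY; apply: YB => //; apply: XY.
    by exists X => //; have [XB _ _] := FP _ FX; apply: XB => //; apply: YX.
  - by have [_ /(_ a x Xx)[Xl Xr] _] := FP _ FX; split; exists X.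
  - by have [_ _] := FP _ FX.
have Amax' B : P B -> (forall x, A x -> B x) -> forall x, B x -> A x.
  move=> PB AB' x Bx; apply: boolp.contrapT => Ax.
  by apply: (Amax B) PB; split=> // BA; apply/Ax/BA.
have A0 : A 0.
  apply: boolp.contrapT => nA0.
  have nA x : ~ A x by move=> Ax; apply: nA0; rewrite -(subrr x); apply: AB.
  apply/nA0/(Amax' (fun x => x = 0)) => // [|x /nA//].
  split=> [x y -> -> | a x -> | /eqP]; rewrite ?subr0 ?mulr0 ?mul0r //.
  by rewrite (negPf c0).
exists A; split=> // B [_ BB BM] AB' Bc.
exact: (Amax' B).
Qed.

(* A two-sided ideal maximal among those avoiding a given nonzero commutator
   has a quotient without nontrivial central idempotents; as all idempotents
   of a ring with [x ^+ Q = x] are central, that quotient is a division ring. *)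
Lemma periodic_comm (S : nzRingType) (p Q : nat) :
  prime p -> p%:R = 0 :> S -> (p %| Q)%N -> (1 < Q)%N ->
  (forall x : S, x ^+ Q = x) -> commutative (@GRing.mul S).
Proof.
move=> p_pr p0 pQ Q1 perS x0 y0; apply/eqP; case: eqP => // /eqP.
rewrite -subr_eq0; set c := _ - _ => c0.
have Q1_gt0 : (0 < Q.-1)%N by case: Q Q1 {pQ perS} => [|[|]].
have sqr0 (t : S) : t * t = 0 -> t = 0.
  move=> tt; rewrite -(perS t) -(prednK (ltnW Q1)) -(prednK Q1_gt0).
  by rewrite !exprS mulrA tt mul0r.
(* In a reduced ring, [e * z - e * z * e] and [z * e - e * z * e] vanish because they square to
   zero. *)
have idem_central (e z : S) : e * e = e -> e * z = z * e.
  move=> ee.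
  have /sqr0 : (e * z - e * z * e) * (e * z - e * z * e) = 0.
    by rewrite mulrBr !mulrBl !mulrA -!(mulrA _ e e) !ee !subrr.
  have /sqr0 : (z * e - e * z * e) * (z * e - e * z * e) = 0.
    by rewrite mulrBr !mulrBl -!mulrA !(mulrA e e) !ee !subrr.
  by move=> /eqP; rewrite subr_eq0 => /eqP-> /eqP; rewrite subr_eq0 => /eqP.
have [A [[A0 AB AM] Ac Amax]] := maximal_ideal_avoiding c0.
have AD u v : A u -> A v -> A (u + v).
  by move=> Au Av; rewrite -[v]opprK -[- v]sub0r; apply: (AB) => //; apply: (AB).
have A1 : ~ A 1 by move=> /(AM c)[]; rewrite mulr1.
have [D [f [fs fk]]] := quotient_ring (And3 A0 AB AM) A1.
(* [B] is the ideal [A + e S]. If it avoids [c], maximality puts [e] in [A]; if [c = a + e * t],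
   then [(1 - e) * c = (1 - e) * a]. *)
have idemA (e : S) : e * e = e -> A e \/ A ((1 - e) * c).
  move=> ee; pose B u := exists a t, A a /\ u = a + e * t.
  have BI : two_sided B.
    split=> [|u v [a [t [Aa ->]]] [b [s [Ab ->]]]|d u [a [t [Aa ->]]]].
    - by exists 0, 0; split=> //; rewrite mulr0 addr0.
    - exists (a - b), (t - s); split; first exact: AB.
      by rewrite mulrBr opprD addrACA.
    - have [? ?] := AM d _ Aa; split.
        exists (d * a), (d * t); split=> //.
        by rewrite mulrDr !mulrA (idem_central _ d ee).
      by exists (a * d), (t * d); split=> //; rewrite mulrDl !mulrA.
  have [Bc | nBc] := boolp.EM (B c); [right | left].
    case: Bc => a [t [Aa ->]]; rewrite mulrDr (mulrA _ e) (mulrBl e) mul1r ee subrr mul0r addr0.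
    by case: (AM (1 - e) a).
  apply: (Amax B BI) => // [u Au|]; first by exists u, 0; rewrite mulr0 addr0.
  by exists 0, 1; rewrite mulr1 add0r.
have pD : p%:R = 0 :> D by rewrite -(rmorph_nat f) p0 rmorph0.
suff /(_ (f x0) (f y0)) comm : commutative (@GRing.mul D).
  by case: Ac; apply/fk; rewrite /c rmorphB !rmorphM /= comm subrr.
apply: (periodic_division_comm pD (prime_gt0 p_pr) Q1 pQ) => z.
have [r ->] := fs z => fr0; pose e := r ^+ Q.-1.
have re : r * e = r by rewrite -exprS (prednK (ltnW Q1)).
have ee : e * e = e.
  by rewrite {1}/e -(prednK Q1_gt0) exprSr -mulrA re -exprSr (prednK Q1_gt0).
have nAe : ~ A e.
  by case/(AM r); rewrite re => /fk rA _; rewrite rA eqxx in fr0.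
have ee1 : (1 - e) * (1 - e) = 1 - e.
  by rewrite mulrBl mul1r mulrBr mulr1 ee subrr subr0.
have Ae1 : A ((1 - e) * c) by case: (idemA e).
(* Either [1 - e] is in [A], which says that the image of [r ^+ Q.-1] is 1, or both [e * c] and
   [(1 - e) * c] are in [A], hence also [c]. *)
have [/fk | Ae] := idemA _ ee1.
  by rewrite rmorphB rmorph1 -rmorphXn => /eqP; rewrite subr_eq0 => /eqP.
rewrite subKr in Ae; case: Ac.
by have := AD _ _ Ae1 Ae; rewrite -mulrDl subrK mul1r.
Qed.

(** * Integer polynomials modulo p *)

Section ReductionModp.

Variable p : nat.
Hypothesis p_pr : prime p.
Local Notation red := (map_poly (intr : int -> 'F_p)).

Lemma intr_Fp_eq0 (n : int) : (n%:~R == 0 :> 'F_p) = (p %| n)%Z.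
Proof. by rewrite (dvdz_pcharf (pchar_Fp p_pr)). Qed.

Lemma red_surj (A : {poly 'F_p}) : exists B, red B = A.
Proof.
exists (map_poly (fun a : 'F_p => (a : nat)%:Z) A); apply/polyP => i.
by rewrite coef_map /= coef_map_id0 // -pmulrn natr_Zp.
Qed.

Lemma red_eq0 (A : {poly int}) : red A = 0 -> exists W, A = W * p%:R.
Proof.
move=> A0; exists (map_poly (fun n => (n %/ p)%Z) A).
apply/polyP => i; rewrite mulr_natr coefMn coef_map_id0 ?div0z // -mulr_natr.
by rewrite natz divzK // -intr_Fp_eq0; have /polyP/(_ i) := A0; rewrite coef_map coef0 => /eqP.
Qed.

Lemma red_dvdp (F A : {poly int}) : red F %| red A ->
  exists H W, A = H * F + W * p%:R.
Proof.
move=> /dvdpP[h rA]; have [H rH] := red_surj h.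
have [|W AW] := @red_eq0 (A - H * F).
  by rewrite rmorphB rmorphM /= rH rA subrr.
by exists H, W; rewrite -AW addrC subrK.
Qed.

Lemma exprB_pchar (R : comNzRingType) (x y : R) m : p \in [pchar R] ->
  (x - y) ^+ (p ^ m) = x ^+ (p ^ m) - y ^+ (p ^ m).
Proof.
move=> pR; elim: m => [|m IH]; first by rewrite !expr1.
by rewrite expnSr !exprM IH -!(pFrobenius_autE pR) rmorphB.
Qed.

(* Two powers [X^(p^a)] and [X^(p^b)] with [a < b] agree modulo [F] by the
   pigeonhole principle, and their difference is a [p^a]-th power. *)
Lemma dvdp_frobenius_power (F : {poly 'F_p}) : F != 0 ->
  exists a f, (0 < f)%N /\ F %| ('X - 'X^(p ^ f)) ^+ (p ^ a).
Proof.
move=> F0; pose T := 'rV['F_p]_(size F).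
pose g (i : 'I_#|T|.+1) : T := poly_rV ('X^(p ^ i) %% F).
have [inj_g | /injectivePn[i [j ij gij]]] := boolP (injectiveb g).
  by have := leq_card _ (injectiveP _ inj_g); rewrite card_ord ltnn.
wlog ltij : i j ij gij / (i < j)%N.
  move=> IH; have := ij; rewrite -val_eqE /= neq_ltn => /orP[]; first exact: IH.
  by apply: IH => //; rewrite eq_sym.
exists i, (j - i)%N; rewrite subn_gt0 ltij; split=> //.
rewrite exprB_pchar; last by rewrite pchar_poly pchar_Fp.
rewrite -exprM -expnD subnK ?(ltnW ltij) //.
have : 'X^(p ^ i) %% F = 'X^(p ^ j) %% F.
  have le_mod A : (size (modp A F) <= size F)%N by rewrite ltnW ?ltn_modpN0.
  by rewrite -[LHS](poly_rV_K (le_mod _)) -[RHS](poly_rV_K (le_mod _)) -/(g i) gij.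
move=> mod_ij; apply/dvdpP; exists ('X^(p ^ i) %/ F - 'X^(p ^ j) %/ F).
rewrite mulrBl {1}(divp_eq 'X^(p ^ i) F) {1}(divp_eq 'X^(p ^ j) F) mod_ij.
by rewrite opprD addrACA subrr addr0.
Qed.

(** Modulo [p], ['X^p - 'X] is the product of the distinct factors ['X - x] over ['F_p], and each of
    them divides [P]. *)
Lemma vanish_modp_ideal (P : {poly int}) :
  (forall a : int, (p %| P.[a])%Z) -> in_ideal2 (p%:R : {poly int}) ('X^p - 'X) P.
Proof.
move=> P0; have [|H [W ->]] := @red_dvdp ('X^p - 'X) P; last first.
  by exists W, H; rewrite addrC.
rewrite rmorphB /= map_polyXn map_polyX.
have -> : 'X^p - 'X = \prod_(x : 'F_p) ('X - x%:P).
  by rewrite -finField_genPoly card_Fp.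
rewrite -(big_map _ xpredT (fun x => 'X - x%:P)).
rewrite uniq_roots_dvdp ?uniq_rootsE ?map_inj_uniq ?index_enum_uniq //.
apply/allP => a _; rewrite -[a]natr_Zp pmulrn /root horner_map /= intr_Fp_eq0.
exact: P0.
Qed.

End ReductionModp.

(** * Commutativity from a central polynomial *)

Lemma exprD_pchar_comm (R : nzRingType) p (x y : R) m : p \in [pchar R] ->
  GRing.comm x y -> (x + y) ^+ (p ^ m) = x ^+ (p ^ m) + y ^+ (p ^ m).
Proof.
move=> pR cxy; elim: m => [|m IH]; first by rewrite !expr1.
rewrite expnSr !exprM IH -!(pFrobenius_autE pR) pFrobenius_autD_comm //.
by apply/commrX/commr_sym/commrX/commr_sym.
Qed.

Definition central (R : nzRingType) (z : R) := forall y, GRing.comm y z.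
Definition bracket (R : nzRingType) (x y : R) := x * y - y * x.

Section Bracket.

Variable R : nzRingType.
Implicit Types x y z : R.

Lemma comm_bracket x y : GRing.comm x y <-> bracket x y = 0.
Proof. by split=> [xy | /eqP]; [apply/eqP|]; rewrite subr_eq0; [apply/eqP | move/eqP]. Qed.

Lemma bracket_central_mull z x y : central z -> bracket x (z * y) = z * bracket x y.
Proof. by move=> zC; rewrite /bracket mulrBr !mulrA (zC x). Qed.

Lemma bracketMl x y z : bracket x (y * z) = bracket x y * z + y * bracket x z.
Proof. by rewrite /bracket mulrBl mulrBr !mulrA addrA subrK. Qed.

Lemma bracketBl x y z : bracket (x - y) z = bracket x z - bracket y z.
Proof.
rewrite /bracket mulrBl mulrBr !opprB addrACA [RHS]addrACA.
by congr (_ + _); apply: addrC.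
Qed.

(** Leibniz rule for the derivation [bracket _ y], whose value at [x] commutes with [x]. For [n = 0]
    both sides are zero despite the truncated [n.-1]. *)
Lemma bracket_expr x y n : GRing.comm x (bracket x y) ->
  bracket (x ^+ n) y = bracket x y * x ^+ n.-1 *+ n.
Proof.
move=> xc; elim: n => [|[|n] IH]; first by rewrite mulr0n /bracket mul1r mulr1 subrr.
  by rewrite !expr1 mulr1n expr0 mulr1.
have -> : bracket (x ^+ n.+2) y = x * bracket (x ^+ n.+1) y + bracket x y * x ^+ n.+1.
  by rewrite /bracket mulrBr mulrBl !mulrA -(mulrA y x) -!exprS addrA subrK.
by rewrite IH mulrnAr mulrA xc -mulrA -exprS [RHS]mulrSr.
Qed.

Lemma central_int (n : int) : central (n%:~R : R).
Proof. by move=> y; apply: commr_int. Qed.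

End Bracket.

(** * Evaluation of integer polynomials and elimination of higher terms *)

Section IntEval.

Variable R : nzRingType.

(** A form of [int_eval] with [r] fixed first, so that it carries a ring morphism structure. *)
Definition int_eval_at (r : R) : {poly int} -> R :=
  horner_morph (fun n => commr_int r n : GRing.comm r (intr n)).

HB.instance Definition _ (r : R) := GRing.RMorphism.on (int_eval_at r).

Lemma int_eval_atE r P : int_eval_at r P = int_eval P r.
Proof. by []. Qed.

Lemma int_eval_sum n (P : {poly int}) (r : R) : (size P <= n)%N ->
  int_eval P r = \sum_(i < n) (P`_i)%:~R * r ^+ i.
Proof.
move=> leP; rewrite /int_eval (@horner_coef_wide _ n) ?(leq_trans (size_poly _ _)) //.
by apply: eq_bigr => i _; rewrite coef_map.
Qed.

(** The range reaches one index past the degree, where the coefficient is zero; this avoids a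
    predecessor of [size E]. *)
Lemma int_eval_linear (E : {poly int}) (r : R) : E`_0 = 0 ->
  int_eval E r = \sum_(i < size E) (E`_i.+1)%:~R * r ^+ i.+1.
Proof.
move=> E0; rewrite (@int_eval_sum (size E).+1) // big_ord_recl /= E0 mul0r add0r.
by apply: eq_bigr.
Qed.

(* [f (z r) - z^(n+1) f r] has lost the term of degree [n+1] of [f r]; after all
   terms of degree at least 2 are gone only the linear one remains. *)
Lemma central_eliminate (z : R) n (a : nat -> R) :
  central z -> (forall i, central (a i)) ->
  (forall r, central (\sum_(i < n.+1) a i * r ^+ i.+1)) ->
  forall r, central ((\prod_(1 <= j < n.+1) (z - z ^+ j.+1)) * a 0%N * r).
Proof.
move=> zC; elim: n a => [|n IH] a aC sumC r.
  by rewrite big_nil mul1r; have := sumC r; rewrite big_ord1 expr1.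
rewrite big_nat_recr //= -(mulrA _ _ (a 0%N)).
apply: (IH (fun i => (z ^+ i.+1 - z ^+ n.+2) * a i)) => [i y | {}r y].
  by apply: commrM (aC i y); apply: commrB; apply: commrX; apply: zC.
have -> : \sum_(i < n.+1) (z ^+ i.+1 - z ^+ n.+2) * a i * r ^+ i.+1 =
  \sum_(i < n.+2) a i * (z * r) ^+ i.+1 - z ^+ n.+2 * \sum_(i < n.+2) a i * r ^+ i.+1.
  rewrite mulr_sumr -sumrB [RHS]big_ord_recr /=.
  have term i : a i * (z * r) ^+ i.+1 - z ^+ n.+2 * (a i * r ^+ i.+1) =
                (z ^+ i.+1 - z ^+ n.+2) * a i * r ^+ i.+1.
    have zr : GRing.comm z r by apply/commr_sym/zC.
    rewrite exprMn_comm // mulrBl mulrBl !mulrA; congr (_ * _ - _).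
    by apply/commrX/zC.
  rewrite term subrr !mul0r addr0; apply: eq_bigr => i _; by rewrite term.
apply: commrB (sumC (z * r) y) _; apply: commrM (sumC r y).
exact/commrX/zC.
Qed.

End IntEval.

Lemma coprimez_annihilate (R : nzRingType) (m n : int) (x : R) :
  coprimez m n -> m%:~R * x = 0 -> n%:~R * x = 0 -> x = 0.
Proof.
move=> /coprimezP[[u v] /= uv] mx nx.
have e1 : 1 = (u * m + v * n)%:~R :> R by rewrite uv.
by rewrite -[x]mul1r e1 rmorphD !rmorphM /= mulrDl -!mulrA mx nx !mulr0 addr0.
Qed.

(** * Commutativity when a power of [p] kills all commutators *)

Section CentralPolynomial.

Variables (R : nzRingType) (E : {poly int}) (p k : nat).
Hypotheses (p_pr : prime p) (pk_bracket : forall x y : R, (p ^ k)%:R * bracket x y = 0).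
Hypotheses (E_central : central_identity R E) (E0 : E`_0 = 0) (E1 : ~~ (p %| E`_1)%Z).

Local Notation n := (size E).
Local Notation a i := ((E`_i.+1)%:~R : R).

Let E_centralP r : central (\sum_(i < n) a i * r ^+ i.+1).
Proof. by move=> y; rewrite -int_eval_linear //; apply/esym/E_central. Qed.

Let n_gt1 : (1 < n)%N.
Proof. by rewrite ltnNge; apply: contra E1 => n1; rewrite nth_default ?dvdz0. Qed.

(** Commutators are [p]-power torsion and the linear coefficient is prime to [p], so Bezout cancels
    it. *)
Let E1_reg x : central (a 0 * x) -> central x.
Proof.
move=> axC y; apply/comm_bracket.
apply: (coprimez_annihilate (m := E`_1) (n := (p ^ k)%:Z)).
- rewrite coprimezE coprime_sym coprimeXl // prime_coprime //.
- by rewrite -bracket_central_mull; [apply/comm_bracket/axC | apply: central_int].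
- by rewrite -pmulrn pk_bracket.
Qed.

(** Descending induction on the exponent: in the central element [E(w ^+ j)], all terms beyond the
    linear one are higher powers of [w], already central, so the linear term is central too. *)
Lemma central_of_central_powers (w : R) J :
  (forall j, (J <= j)%N -> central (w ^+ j)) -> central w.
Proof.
move=> wJ; suff wC m : forall j, (0 < j)%N -> (J <= j + m)%N -> central (w ^+ j).
  by rewrite -[w]expr1; apply: (wC J) => //; apply: leq_addl.
elim: m => [|m IH] j j0 Jj; first by apply: wJ; rewrite addn0 in Jj.
apply: E1_reg => y; have := E_centralP (w ^+ j) y.
case: n n_gt1 => // n' _; rewrite big_ord_recl /= expr1 => sumC.
rewrite -[a 0 * _](addrK (\sum_(i < n') a i.+1 * (w ^+ j) ^+ i.+2)).
apply: commrB => //; apply: commr_sum => i _; apply: commrM; first exact: commr_int.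
rewrite -exprM; apply: IH; first by rewrite muln_gt0 j0.
by rewrite (leq_trans Jj) // mulnS -addSnnS leq_add2r -addn1 leq_add2l muln_gt0 j0.
Qed.

(** From exponent [k] on, powers of [p%:R * y] contain the factor [p ^ k], which kills commutators,
    so they are central. *)
Lemma p_bracket (x y : R) : p%:R * bracket x y = 0.
Proof.
rewrite -bracket_central_mull; last by move=> z; apply: commr_nat.
apply/comm_bracket; apply: (@central_of_central_powers _ k) => j lekj {x}z.
rewrite exprMn_comm; last exact/commr_sym/commr_nat.
apply/comm_bracket; rewrite -natrX -(subnK lekj) expnD natrM -mulrA.
rewrite bracket_central_mull; last by move=> ?; apply: commr_nat.
rewrite bracket_central_mull ?pk_bracket ?mulr0 // => ?; exact: commr_nat.
Qed.

Definition bracket_ann (c : R) :=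
  forall x y : R, c * bracket x y = 0 /\ bracket x y * c = 0.

(** By the Leibniz rule [b * bracket x y] is [bracket x (b * y) - bracket x b * y], so a left
    annihilator of commutators kills it; the right side is symmetric. *)
Lemma bracket_ann_two_sided : two_sided bracket_ann.
Proof.
split=> [x y | c d Kc Kd x y | b c Kc]; first by rewrite mul0r mulr0.
  by have [[c1 c2] [d1 d2]] := (Kc x y, Kd x y); rewrite (mulrBl (bracket x y)) (mulrBr (bracket x y)) c1 c2 d1 d2 subrr.
have cl x y : c * bracket x y = 0 by case: (Kc x y).
have cr x y : bracket x y * c = 0 by case: (Kc x y).
split=> x y; split; rewrite -?mulrA ?cl ?mulr0 // ?mulrA ?cr ?mul0r //.
  have : bracket x (y * b) * c = 0 by apply: cr.
  by rewrite bracketMl mulrDl -!mulrA cr mulr0 addr0.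
have : c * bracket x (b * y) = 0 by apply: cl.
by rewrite bracketMl mulrDr !mulrA cl mul0r add0r.
Qed.

Lemma bracket_ann_central c : central c ->
  (forall x y, c * bracket x y = 0) -> bracket_ann c.
Proof. by move=> cC c0 x y; rewrite (cC (bracket x y)) c0. Qed.

Lemma bracket_ann_p : bracket_ann p%:R.
Proof.
by apply: bracket_ann_central => [? | x y]; [apply: commr_nat | apply: p_bracket].
Qed.

(** [c * d * y = c * y * d] because [c] kills [bracket d y], and [c * y * d = y * c * d] because [d]
    kills [bracket y c]. *)
Lemma bracket_ann_mul_central c d : bracket_ann c -> bracket_ann d -> central (c * d).
Proof.
move=> Kc Kd y; rewrite /GRing.comm.
have [/eqP + _] := Kc d y; rewrite /bracket mulrBr subr_eq0 !mulrA => /eqP ->.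
by have [_ /eqP] := Kd y c; rewrite /bracket mulrBl subr_eq0 => /eqP ->.
Qed.

Lemma bracket_ann_of_mul_central c : central c ->
  (forall r, central (c * r)) -> bracket_ann c.
Proof.
move=> cC crC; apply: bracket_ann_central => // x y.
by rewrite -bracket_central_mull //; apply/comm_bracket/crC.
Qed.

Definition elim_poly : {poly int} := \prod_(1 <= j < n) (E - E ^+ j.+1).

(** The value [E(x)] is central, hence a legitimate multiplier for [central_eliminate]; [E1_reg]
    then removes the linear coefficient. *)
Lemma elim_poly_ann x : bracket_ann (int_eval elim_poly x).
Proof.
pose z := int_eval E x.
have zC : central z by move=> y; apply/esym/E_central.
have -> : int_eval elim_poly x = \prod_(1 <= j < n) (z - z ^+ j.+1).
  by rewrite -int_eval_atE rmorph_prod; apply: eq_bigr => j _; rewrite rmorphB rmorphXn.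
set g := \prod_(_ <= _ < _) _.
have gC : central g.
  by move=> y; apply: commr_prod => j _; apply: commrB => //; apply: commrX.
apply: bracket_ann_of_mul_central => // r; apply: E1_reg.
have -> : a 0 * (g * r) = g * a 0 * r by rewrite mulrA (gC (a 0)).
rewrite /g; move: E_centralP; case: n n_gt1 => // m _ sumC.
exact: (central_eliminate zC (fun i => @central_int R (E`_i.+1)) sumC).
Qed.

(** [E] stays nonconstant modulo [p], so [E] and [E ^+ j.+1] differ in degree for [j > 0] and no
    factor vanishes. *)
Lemma elim_poly_modp : map_poly (intr : int -> 'F_p) elim_poly != 0.
Proof.
rewrite rmorph_prod prodf_seq_neq0 /=; apply/allP => j; rewrite mem_index_iota.
case/andP=> j0 _; rewrite rmorphB rmorphXn /= subr_eq0.
set F := map_poly _ E.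
have F1 : F`_1 != 0 by rewrite coef_map /= intr_Fp_eq0.
have sF : (1 < size F)%N by rewrite ltnNge; apply: contra F1 => /leq_sizeP->.
apply: contraTneq j0 => /(congr1 (fun A : {poly 'F_p} => (size A).-1)).
rewrite size_exp -[LHS]muln1 => /eqP; rewrite eqn_pmul2l ?eqSS -?lt0n //.
  by move/eqP <-.
by case: (size F) sF => [|[]].
Qed.

(** Some [('X - 'X^q) ^+ s] lies in the ideal generated by [elim_poly] and [p], and both of these
    take values in the ideal [bracket_ann]. *)
Lemma bracket_ann_frobenius : exists q f s, [/\ q = (p ^ f)%N, (0 < f)%N
  & forall x, bracket_ann ((x - x ^+ q) ^+ s)].
Proof.
have [b [f [f0 /= dvF]]] := dvdp_frobenius_power p_pr elim_poly_modp.
exists (p ^ f)%N, f, (p ^ b)%N; split=> // x.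
have [|H [W EH]] := @red_dvdp p p_pr elim_poly (('X - 'X^(p ^ f)) ^+ (p ^ b)).
  by rewrite rmorphXn rmorphB /= map_polyX map_polyXn.
have [_ KB KM] := bracket_ann_two_sided.
have KD c d : bracket_ann c -> bracket_ann d -> bracket_ann (c + d).
  move=> Kc Kd x' y; have [[c1 c2] [d1 d2]] := (Kc x' y, Kd x' y).
  by rewrite (mulrDl c d) (mulrDr (bracket x' y) c d) c1 c2 d1 d2 addr0.
have xE : int_eval_at x 'X = x by rewrite int_eval_atE /int_eval map_polyX hornerX.
have /(congr1 (int_eval_at x)) := EH.
rewrite rmorphXn rmorphB rmorphXn /= xE => ->.
rewrite rmorphD !rmorphM rmorph_nat.
apply: KD; first by case: (KM (int_eval_at x H) _ (elim_poly_ann x)).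
by case: (KM (int_eval_at x W) _ bracket_ann_p).
Qed.

Theorem central_polynomial_comm : commutative (@GRing.mul R).
Proof.
have [q [f [s [qE f0 Ks]]]] := bracket_ann_frobenius.
have pq : (p %| q)%N by rewrite qE dvdn_exp.
(* Powers with exponent at least [2s] are products of two annihilators of commutators, hence
   central. *)
have nC (x : R) : central (x - x ^+ q).
  apply: (@central_of_central_powers (x - x ^+ q) (s + s)) => j lesj.
  rewrite -(subnK lesj) addnA exprD; apply: bracket_ann_mul_central => //.
  rewrite exprD; have [_ _ KM] := bracket_ann_two_sided.
  by case: (KM ((x - x ^+ q) ^+ (j - (s + s))) _ (Ks x)).
(* Centrality of [x - x ^+ q] is used at both [r] and [z * r]. *)
have Kz (z : R) : central z -> bracket_ann (z - z ^+ q).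
  move=> zC; apply: bracket_ann_of_mul_central => [y | r y].
    by apply: commrB => //; apply: commrX.
  have -> : (z - z ^+ q) * r = (z * r - (z * r) ^+ q) - z ^+ q * (r - r ^+ q).
    have zr : GRing.comm z r by apply/commr_sym/zC.
    by rewrite mulrBl exprMn_comm // mulrBr opprB addrA subrK.
  by apply: commrB; [apply: nC | apply: commrM; [apply: commrX | apply: nC]].
have K_all x y : bracket_ann (bracket x y).
  have [K1 | K1] := boolp.EM (bracket_ann 1).
    move=> u v; have [+ _] := K1 x y; rewrite mul1r => ->.
    by rewrite mul0r mulr0.
  have [S [g [gs gk]]] := quotient_ring bracket_ann_two_sided K1.
  have pS : p%:R = 0 :> S by rewrite -(rmorph_nat g); apply/gk/bracket_ann_p.
  have pcharS : p \in [pchar S] by rewrite inE p_pr pS eqxx.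
  have qj_gt1 j : (0 < j)%N -> (1 < q ^ j)%N.
    by move=> j0; rewrite qE -expnM -(expn0 p) ltn_exp2l ?prime_gt1 // muln_gt0 f0.
  have perS (t : S) : t ^+ (q ^ p) = t.
    have [r ->] := gs t; pose w := g r - g r ^+ q.
    have wq : w ^+ q = w.
      apply/esym/eqP; rewrite -subr_eq0; apply/eqP.
      by have /gk := Kz _ (nC r); rewrite rmorphB !rmorphXn rmorphB rmorphXn.
    (* Raising to the power [q] is additive on commuting elements and fixes [w]; after [p] rounds
       the copies of [w] add up to zero. *)
    have iter j : g r = g r ^+ (q ^ j) + w *+ j.
      elim: j => [|j IH]; first by rewrite mulr0n addr0.
      have gE : g r = g r ^+ q + w by rewrite /w addrC subrK.
      have cw : GRing.comm (g r ^+ q) w.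
        by apply/commrB; [|apply/commrX]; apply/commr_sym/commrX.
      have wqj i : w ^+ (q ^ i) = w.
        by elim: i => // i IHi; rewrite expnS exprM wq.
      have frob i (u v : S) : GRing.comm u v ->
          (u + v) ^+ (q ^ i) = u ^+ (q ^ i) + v ^+ (q ^ i).
        by rewrite qE -expnM; apply: exprD_pchar_comm.
      by rewrite {1}IH {1}gE frob // wqj -exprM -expnS -addrA -mulrS.
    by rewrite [RHS](iter p) -mulr_natr pS mulr0 addr0.
  have pQ : (p %| q ^ p)%N by rewrite dvdn_exp ?prime_gt0.
  have cS := periodic_comm p_pr pS pQ (qj_gt1 _ (prime_gt0 p_pr)) perS.
  by apply/gk; rewrite /bracket rmorphB !rmorphM /= cS subrr.
move=> x y; apply/comm_bracket; set c := bracket x y.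
have cC : central c.
  apply: (@central_of_central_powers c 2) => -[|[|j]] // _ z.
  have [cc _] := K_all x y x y.
  by rewrite !exprS mulrA cc mul0r; apply: commr0.
have -> : c = bracket (x ^+ q) y.
  have /comm_bracket : GRing.comm (x - x ^+ q) y by apply/commr_sym/nC.
  by rewrite bracketBl => /eqP; rewrite subr_eq0 => /eqP.
rewrite bracket_expr; last exact: cC.
by case/dvdnP: pq => t ->; rewrite mulnC mulrnA -(mulr_natl _ p) mulrA p_bracket mul0r mul0rn.
Qed.

End CentralPolynomial.

(** * Translation and torsion of commutators *)

Lemma int_eval_rmorph (R S : nzRingType) (f : {rmorphism R -> S}) P r :
  f (int_eval P r) = int_eval P (f r).
Proof.
rewrite /int_eval -horner_map -map_poly_comp; congr _.[_].
by apply: eq_map_poly => i /=; rewrite rmorph_int.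
Qed.

Lemma int_eval_comp (R : nzRingType) (P Q : {poly int}) (r : R) :
  int_eval (P \Po Q) r = int_eval P (int_eval Q r).
Proof.
elim/poly_ind: P => [|P c IH]; first by rewrite comp_poly0 /int_eval rmorph0 !horner0.
rewrite comp_poly_MXaddC -!int_eval_atE !rmorphD !rmorphM /= !int_eval_atE IH.
by rewrite /int_eval !map_polyC !map_polyX !hornerC !hornerX.
Qed.

Lemma int_eval_int (R : nzRingType) (P : {poly int}) (a : int) :
  int_eval P (a%:~R : R) = (P.[a])%:~R.
Proof. by rewrite /int_eval horner_map. Qed.

Lemma int_poly_nonroot (P : {poly int}) : P != 0 -> exists a : int, P.[a] != 0.
Proof.
move=> P0; pose s := [seq i%:Z | i <- iota 0 (size P)].
have [/allP sr | /allPn[a _ Pa]] := boolP (all (root P) s); last by exists a.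
have := max_poly_roots P0 (introT allP sr).
by rewrite map_inj_uniq ?iota_uniq ?size_map ?size_iota ?ltnn => [/(_ isT)|i j []].
Qed.

(** Integers are central, so translating by one and subtracting the constant term keep values
    central, while [P'(a)] becomes the linear coefficient. *)
Lemma central_translate (P : {poly int}) (a : int) :
  exists E : {poly int}, [/\ E`_0 = 0, E`_1 = P^`().[a]
    & forall R : nzRingType, central_identity R P -> central_identity R E].
Proof.
exists (P \Po ('X + a%:P) - P.[a]%:P); split=> [||R PC r t].
- by rewrite -horner_coef0 hornerD hornerN hornerC horner_comp !hornerE subrr.
- transitivity (P \Po ('X + a%:P) - P.[a]%:P)^`()`_0; first by rewrite coef_deriv mulr1n.
  by rewrite -horner_coef0 derivB derivC subr0 deriv_comp derivD derivX derivC !hornerE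
     horner_comp !hornerE.
- rewrite -int_eval_atE rmorphB /= !int_eval_atE int_eval_comp.
  rewrite mulrBl mulrBr PC; congr (_ - _).
  by rewrite /int_eval map_polyC hornerC; apply/esym/commr_int.
Qed.

(** Elimination with the integer multiplier 2, whose factors [2 - 2 ^+ j.+1] are nonzero, after a
    translation that makes the linear coefficient nonzero. *)
Lemma central_identity_torsion (R : nzRingType) (P : {poly int}) :
  central_identity R P -> P^`() != 0 ->
  exists2 D : int, D != 0 & forall x y : R, D%:~R * bracket x y = 0.
Proof.
move=> PC /int_poly_nonroot[a Pa].
have [E [E0 E1 /(_ R PC) EC]] := central_translate P a.
have sE : (1 < size E)%N.
  by rewrite ltnNge; apply: contra Pa => sE; rewrite -E1 nth_default.
exists ((\prod_(1 <= j < size E) (2 - 2 ^+ j.+1)) * E`_1).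
  rewrite mulf_neq0 ?E1 // prodf_seq_neq0; apply/allP => j.
  rewrite mem_index_iota => /andP[j0 _] /=; rewrite subr_eq0 -{1}(expr1 2).
  by rewrite -!natrX Num.Theory.eqr_nat eqn_exp2l // ltn_eqF.
move=> x y; rewrite -bracket_central_mull; last exact: central_int.
apply/comm_bracket; rewrite rmorphM rmorph_prod /=.
rewrite (eq_bigr (fun j => (2 : R) - 2 ^+ j.+1)); last first.
  by move=> j _; rewrite rmorphB rmorphXn /= !rmorph_nat.
have := fun r : R => esym (int_eval_linear r E0).
case: (size E) sE => // n _ sumE.
apply: (central_eliminate (a := fun i => (E`_i.+1)%:~R)) => [? | i | r t].
- exact: commr_nat.
- exact: central_int.
- by rewrite sumE; apply/esym/EC.
Qed.

(** With [n] the least positive integer killing [bracket x y] and [q] a prime factor of [n], the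
    multiple by [n / q] is nonzero, killed by [q], and again a commutator. *)
Lemma prime_torsion_bracket (R : nzRingType) (D : int) :
  noncommutative R -> D != 0 -> (forall x y : R, D%:~R * bracket x y = 0) ->
  exists p (x y : R), [/\ prime p, bracket x y != 0 & p%:R * bracket x y = 0].
Proof.
move=> ncR D0 killD.
have [x [y xy0]] : exists x y : R, bracket x y != 0.
  apply: boolp.contrapT => noxy; apply: ncR => x y; apply/comm_bracket/eqP.
  by apply: boolp.contrapT => /negP xy; apply: noxy; exists x, y.
pose kills n := (0 < n)%N && (n%:R * bracket x y == 0).
have exn : exists n, kills n.
  exists `|D|%N; rewrite /kills absz_gt0 D0 /=.
  case: D killD {D0} => n /(_ x y); first by move=> ->.
  by rewrite NegzE rmorphN mulNr => /eqP; rewrite oppr_eq0.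
case: (ex_minnP exn) => n /andP[n0 /eqP nxy] minn.
have n1 : (1 < n)%N.
  rewrite ltn_neqAle n0 andbT; apply: contraNneq xy0 => n1.
  by rewrite -n1 mul1r in nxy; rewrite nxy.
have [q q_pr qn] : exists2 q, prime q & (q %| n)%N.
  by exists (pdiv n); [apply: pdiv_prime | apply: pdiv_dvd].
exists q, x, ((n %/ q)%:R * y).
rewrite bracket_central_mull; last by move=> ?; apply: commr_nat.
rewrite mulrA -natrM mulnC divnK // nxy; split=> //.
apply/negP => nxy'; have /minn : kills (n %/ q)%N.
  by rewrite /kills nxy' andbT divn_gt0 ?prime_gt0 // dvdn_leq.
by rewrite leqNgt ltn_Pdiv // prime_gt1.
Qed.

Lemma coprime_int_prime (p : nat) (n : int) :
  prime p -> ~~ (p %| n)%Z -> coprimez n p.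
Proof. by move=> p_pr pn; rewrite coprimezE coprime_sym prime_coprime. Qed.

(** Write [D] as [m p^k] up to sign, [m] prime to [p]. Modulo the [m]-torsion, [p^k] kills
    commutators, so a [P'(a)] prime to [p] makes the quotient commutative. Then [m] and [p] both
    kill [bracket x y], which must be zero. *)
Lemma derivative_vanishes_modp (R : nzRingType) (P : {poly int}) (D : int) p (x y : R) :
  central_identity R P -> D != 0 -> (forall x y : R, D%:~R * bracket x y = 0) ->
  prime p -> bracket x y != 0 -> p%:R * bracket x y = 0 ->
  forall a : int, (p %| P^`().[a])%Z.
Proof.
move=> PC D0 killD p_pr xy0 pxy a; apply: contraNT xy0 => Pa; apply/eqP.
have [E [E0 E1 EC]] := central_translate P a.
have D_gt0 : (0 < `|D|)%N by rewrite absz_gt0.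
have [m pm Dm] := pfactor_coprime p_pr D_gt0; set k := logn p _ in Dm.
have killm (u v : R) : m%:R * ((p ^ k)%:R * bracket u v) = 0.
  rewrite mulrA -natrM -Dm; case: D {D0 D_gt0 Dm k} killD => n /(_ u v); first by [].
  by rewrite NegzE rmorphN mulNr => /eqP; rewrite oppr_eq0 => /eqP.
have mxy_neq0 : m%:R * bracket x y = 0 -> bracket x y = 0.
  by apply: (@coprimez_annihilate R p m); rewrite ?coprimezE.
pose J r := m%:R * r = 0 :> R.
have JI : two_sided J.
  split=> [|u v Ju Jv|b u Ju]; rewrite /J ?mulr0 ?mulrBr ?Ju ?Jv ?subrr //.
  by split; rewrite mulrA ?Ju ?mul0r // -(commr_nat b) -mulrA Ju mulr0.
have [J1 | J1] := boolp.EM (J 1).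
  by apply: mxy_neq0; rewrite -[bracket x y]mul1r mulrA J1 mul0r.
have [S [f [fs fk]]] := quotient_ring JI J1.
have fB (u v : R) : f (bracket u v) = bracket (f u) (f v).
  by rewrite /bracket rmorphB !rmorphM.
apply/mxy_neq0/fk; rewrite fB; apply/comm_bracket.
apply: (@central_polynomial_comm S E p k) => // [u v | u v |]; last by rewrite E1.
  have [[u' ->] [v' ->]] := (fs u, fs v).
  by rewrite -fB -(rmorph_nat f) -rmorphM; apply/fk/killm.
have [[u' ->] [v' ->]] := (fs u, fs v).
by rewrite -int_eval_rmorph -!rmorphM (EC R PC).
Qed.

(** * Triangular matrix rings *)

Section Subring.

Variables (R : nzRingType) (S : {pred R}).
Hypothesis S_closed : subring_closed S.

Definition subring_of : Type := {x : R | x \in S}.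
HB.instance Definition _ := SubChoice.on subring_of.
HB.instance Definition _ :=
  GRing.SubChoice_isSubNzRing.Build R (mem S) subring_of S_closed.

Lemma subring_exists : exists (T : nzRingType) (g : {rmorphism T -> R}),
  [/\ injective g, forall t, g t \in S & forall r, r \in S -> exists t, g t = r].
Proof.
exists subring_of, val; split; [exact: val_inj | exact: valP | move=> r Sr].
by exists (exist _ r Sr).
Qed.

End Subring.

Section UpperTriangular.

Variables (F : comNzRingType) (m : nat).
Implicit Types A B : 'M[F]_m.+1.

(** Filtration by superdiagonals, additive under products: [k = 0] means triangular, [k = 1]
    strictly triangular, and [k = m.+1] forces zero. *)
Definition upper k A := [forall i : 'I_m.+1, forall j : 'I_m.+1, (j < i + k)%N ==> (A i j == 0)].

Lemma upperP k A :
  reflect (forall i j : 'I_m.+1, (j < i + k)%N -> A i j = 0) (upper k A).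
Proof.
apply: (iffP forallP) => [UA i j ltj | UA i].
  by have /forallP/(_ j)/implyP/(_ ltj)/eqP := UA i.
by apply/forallP => j; apply/implyP => /UA ->.
Qed.

Lemma upperB k A B : upper k A -> upper k B -> upper k (A - B).
Proof.
move=> /upperP UA /upperP UB; apply/upperP => i j ltj.
by rewrite !mxE UA ?UB ?subrr.
Qed.

Lemma upperM k l A B : upper k A -> upper l B -> upper (k + l) (A * B).
Proof.
move=> /upperP UA /upperP UB; apply/upperP => i j ltj; rewrite mxE big1 // => t _.
have [lti | leit] := ltnP t (i + k)%N; first by rewrite UA ?mul0r.
by rewrite UB ?mulr0 // (leq_trans ltj) // addnA leq_add2r.
Qed.

Lemma upper_eq0 A : upper m.+1 A -> A = 0.
Proof.
move/upperP=> UA; apply/matrixP => i j; rewrite mxE UA //.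
by rewrite (leq_trans (ltn_ord j)) ?leq_addl.
Qed.

Lemma upper_scalar a : upper 0 (a%:M : 'M_m.+1).
Proof.
by apply/upperP => i j; rewrite addn0 mxE -val_eqE => /gtn_eqF /= ->.
Qed.

Lemma upperX A n : upper 0 A -> upper 0 (A ^+ n).
Proof.
move=> UA; elim: n => [|n IH]; first exact: upper_scalar.
by rewrite exprS (upperM (k := 0) (l := 0)).
Qed.

Lemma upper_diagM A B i : upper 0 A -> upper 0 B -> (A * B) i i = A i i * B i i.
Proof.
move=> /upperP UA /upperP UB; rewrite mxE (bigD1 i) //= big1 ?addr0 // => t ti.
have [lti | lti | /val_inj e] := ltngtP t i; last by rewrite e eqxx in ti.
  by rewrite UA ?mul0r ?addn0.
by rewrite UB ?mulr0 ?addn0.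
Qed.

Lemma upper_diagX A n i : upper 0 A -> (A ^+ n) i i = A i i ^+ n.
Proof.
move=> UA; elim: n => [|n IH]; first by rewrite !expr0 mxE eqxx.
by rewrite !exprS upper_diagM ?upperX // IH.
Qed.

Lemma upper_strict A : upper 0 A -> (forall i, A i i = 0) -> upper 1 A.
Proof.
move=> /upperP UA dA; apply/upperP => i j; rewrite addn1 ltnS leq_eqVlt.
by case/predU1P=> [/val_inj-> // | ltj]; rewrite UA ?addn0.
Qed.

Lemma upper_subring : subring_closed (upper 0).
Proof.
split=> [|A B|A B]; first exact: upper_scalar.
  exact: upperB.
exact: (upperM (k := 0) (l := 0)).
Qed.

(** Boolean form of being a scalar plus a strictly upper matrix: the scalar can only be the corner
    entry. *)
Definition local_upper A := upper 1 (A - (A 0 0)%:M).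

Lemma local_upperP A :
  reflect (exists a N, upper 1 N /\ A = a%:M + N) (local_upper A).
Proof.
apply: (iffP idP) => [UA | [a [N [UN ->]]]].
  by exists (A 0 0), (A - (A 0 0)%:M); split=> //; rewrite addrC subrK.
rewrite /local_upper; have /upperP N0 := UN.
by rewrite [in X in _ - X]mxE (N0 0 0) // addr0 mxE eqxx mulr1n addrC addKr.
Qed.

Lemma upper_strictM A B : upper 1 A -> upper 0 B -> upper 1 (A * B) /\ upper 1 (B * A).
Proof.
move=> UA UB; split; first exact: (upperM (k := 1) (l := 0)).
exact: (upperM (k := 0) (l := 1)).
Qed.

Lemma upper_weaken A : upper 1 A -> upper 0 A.
Proof.
by move=> /upperP UA; apply/upperP => i j ltj; rewrite UA // addn1 ltnW // -(addn0 i).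
Qed.

Lemma upperD k A B : upper k A -> upper k B -> upper k (A + B).
Proof.
move=> /upperP UA /upperP UB; apply/upperP => i j ltj.
by rewrite !mxE UA ?UB ?addr0.
Qed.

Lemma local_upper_subring : subring_closed local_upper.
Proof.
split=> [|A B|A B].
- apply/local_upperP; exists 1, 0; rewrite addr0; split=> //.
  by apply/upperP => i j _; rewrite mxE.
- move=> /local_upperP[a [N [UN ->]]] /local_upperP[b [M [UM ->]]].
  apply/local_upperP; exists (a - b), (N - M); split; first exact: upperB.
  by rewrite raddfB opprD addrACA.
- move=> /local_upperP[a [N [UN ->]]] /local_upperP[b [M [UM ->]]].
  apply/local_upperP; exists (a * b), (a%:M * M + N * (b%:M + M)); split.
    apply: upperD; first by have [] := upper_strictM UM (upper_scalar a).
    have [] // := upper_strictM UN (upperD (upper_scalar b) (upper_weaken UM)).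
  by rewrite mulrDl mulrDr addrA scalar_mxM.
Qed.

End UpperTriangular.

(** * Noncommutative rings satisfying the identities *)

Section PrimeExamples.

Variable p : nat.
Hypothesis p_pr : prime p.

Lemma zero_identity_example (P : {poly int}) :
  in_ideal2 (p%:R : {poly int}) (('X^p - 'X) ^+ 2) P ->
  exists R : nzRingType, noncommutative R /\ zero_identity R P.
Proof.
move=> [u [v ->]].
have [T [g [inj_g gS Sg]]] := subring_exists (@upper_subring 'F_p 1).
exists T; split.
  move=> cT; have U01 : upper 0 (delta_mx 0 1 : 'M['F_p]_2).
    by apply/upperP => i j; rewrite addn0 mxE; case: eqP => // ->; case: eqP => // ->.
  have U00 : upper 0 (delta_mx 0 0 : 'M['F_p]_2).
    by apply/upperP => i j; rewrite addn0 mxE; case: eqP => // ->.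
  have [[s gs] [t gt]] := (Sg _ U01, Sg _ U00).
  have := cT s t => /(congr1 g); rewrite !rmorphM gs gt.
  rewrite -!mulmxE !mul_delta_mx_cond /= mulr0n mulr1n => /matrixP/(_ 0 1).
  by rewrite !mxE => /eqP; rewrite eq_sym oner_eq0.
move=> t; apply: inj_g; rewrite rmorph0 int_eval_rmorph; set A := g t.
have UA : upper 0 A by apply: gS.
rewrite -int_eval_atE expr2 rmorphD !rmorphM /= rmorph_nat rmorphB rmorphXn /=.
have -> : int_eval_at A 'X = A by rewrite int_eval_atE /int_eval map_polyX hornerX.
have -> : p%:R = 0 :> 'M['F_p]_2 by rewrite -(rmorph_nat (@scalar_mx 'F_p 2)) pchar_Fp_0 // raddf0.
(* Diagonal entries lie in ['F_p] and satisfy [a^p = a]; the square is then in [upper 2], which is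
   zero for 2x2 matrices. *)
have UN : upper 1 (A ^+ p - A).
  apply: upper_strict => [|i]; first by rewrite upperB ?upperX.
  rewrite !mxE upper_diagX // -[X in _ ^+ X](card_Fp p_pr) expf_card subrr //.
by rewrite mulr0 add0r (upper_eq0 (upperM UN UN)) mulr0.
Qed.

Lemma central_identity_example (P : {poly int}) :
  in_ideal2 (p%:R : {poly int}) ('X^p - 'X) P^`() ->
  exists R : nzRingType, noncommutative R /\ central_identity R P.
Proof.
move=> [u [v P'E]].
have [T [g [inj_g gS Sg]]] := subring_exists (@local_upper_subring 'F_p 2).
exists T; split.
  have U01 : local_upper (delta_mx 0 1 : 'M['F_p]_3).
    apply/local_upperP; exists 0, (delta_mx 0 1); rewrite raddf0 add0r; split=> //.
    by apply/upperP => i j; rewrite mxE; case: eqP => // ->; case: eqP => // ->.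
  have U12 : local_upper (delta_mx 1 2%:R : 'M['F_p]_3).
    apply/local_upperP; exists 0, (delta_mx 1 2%:R); rewrite raddf0 add0r; split=> //.
    by apply/upperP => i j; rewrite mxE; case: eqP => // ->; case: eqP => // ->.
  have [[s gs] [t gt]] := (Sg _ U01, Sg _ U12).
  move=> cT; have := cT s t => /(congr1 g); rewrite !rmorphM gs gt.
  rewrite -!mulmxE !mul_delta_mx_cond /= mulr0n mulr1n => /matrixP/(_ 0 2%:R).
  by rewrite !mxE => /eqP; rewrite oner_eq0.
move=> s t; apply: inj_g; rewrite !rmorphM int_eval_rmorph.
have /local_upperP[a [N [UN ->]]] := gS s; have /local_upperP[b [M [UM ->]]] := gS t.
have pM0 : p%:R = 0 :> 'M['F_p]_3.
  by rewrite -(rmorph_nat (@scalar_mx 'F_p 3)) pchar_Fp_0 // raddf0.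
pose Q : {poly 'M['F_p]_3} := map_poly intr P.
(* Scalars from ['F_p] satisfy [a^p = a], so both generators of the ideal vanish at [a%:M]. *)
have Q'a : Q^`().[a%:M] = 0.
  rewrite /Q deriv_map P'E -/(int_eval _ _) -int_eval_atE rmorphD !rmorphM /=.
  rewrite rmorph_nat rmorphB rmorphXn /= pM0 mulr0 add0r.
  have -> : int_eval_at (a%:M : 'M_3) 'X = a%:M.
    by rewrite int_eval_atE /int_eval map_polyX hornerX.
  by rewrite -rmorphXn -[X in _ ^+ X](card_Fp p_pr) expf_card subrr mulr0.
have scal c (B : 'M['F_p]_3) : GRing.comm B c%:M by apply: scalar_mxC.
(* Taylor expansion around the scalar [a%:M]; each term is shown separately to commute with [B]. *)
rewrite /int_eval -/Q nderiv_taylor //; last exact/commr_sym/scal.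
set B := b%:M + M; apply/esym; apply: (@commr_sum _ _ _ _ _ B) => -[i _] _ /=.
case: i => [|[|i]].
- rewrite expr0 mulr1 nderivn0; apply: commr_horner => // j.
  by rewrite /Q coef_map; apply/esym/commr_int.
- by rewrite nderivn1 Q'a mul0r; apply: commr0.
apply: commrM.
  apply: commr_horner => // j.
  rewrite /Q nderivn_map coef_map; apply/esym/commr_int.
(* Products of three strictly upper 3x3 matrices vanish, so from degree 2 on [N ^+ i.+2] is killed
   by [M] on both sides. *)
have U2 := upperM UN UN.
have NNM : N * N * M = 0 by apply/upper_eq0/(upperM U2 UM).
have MNN : M * (N * N) = 0 by apply/upper_eq0/(upperM UM U2).
apply/commr_sym/commrD; first exact: scal.
rewrite /GRing.comm {1}(_ : N ^+ i.+2 = N ^+ i * (N * N)); last first.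
  by rewrite -expr2 -exprD addn2.
by rewrite -mulrA NNM mulr0 !exprS !mulrA -[M * N * N]mulrA MNN mul0r.
Qed.

End PrimeExamples.

(** * From the identities to the ideal conditions *)

Lemma zero_identity_ideal (R : nzRingType) (P : {poly int}) :
  noncommutative R -> zero_identity R P ->
  exists p : nat, prime p /\ in_ideal2 (p%:R : {poly int}) (('X^p - 'X) ^+ 2) P.
Proof.
move=> ncR P0; have [-> | Pn0] := eqVneq P 0.
  (* The zero polynomial lies in the ideal for every prime; 2 is an arbitrary choice. *)
  by exists 2; split=> //; exists 0, 0; rewrite !mul0r addr0.
have [b Pb] := int_poly_nonroot Pn0.
have Pkill (a : int) : (P.[a])%:~R = 0 :> R by rewrite -int_eval_int P0.
have kill (x y : R) : (P.[b])%:~R * bracket x y = 0 by rewrite Pkill mul0r.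
have PC : central_identity R P by move=> r t; rewrite P0 mul0r mulr0.
have [p [x [y [p_pr xy0 pxy]]]] := prime_torsion_bracket ncR Pb kill.
have P'a := derivative_vanishes_modp PC Pb kill p_pr xy0 pxy.
have Pa (a : int) : (p %| P.[a])%Z.
  apply: contraNT xy0 => Pa; apply/eqP.
  apply: (@coprimez_annihilate R P.[a] p) => //; first exact: coprime_int_prime.
  by rewrite Pkill mul0r.
exists p; split=> //; have [u [v Puv]] := vanish_modp_ideal p_pr Pa.
(* Differentiating [P = u p + v (X^p - X)] gives [P'(a) = - v(a)] modulo [p], so [v] is again
   divisible by [X^p - X] modulo [p]. *)
have va (a : int) : (p %| v.[a])%Z.
  have := P'a a; rewrite -!(intr_Fp_eq0 p_pr) Puv.
  rewrite derivD !derivM derivB derivXn derivX -polyC_natr derivC !hornerE /=.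
  rewrite hornerMn !hornerE.
  rewrite !(rmorphD, rmorphB, rmorphM, rmorphXn, rmorphMn) /=.
  have p0 : p%:R = 0 :> 'F_p by exact: pchar_Fp_0.
  have ap : (a%:~R : 'F_p) ^+ p = a%:~R.
    by rewrite -[X in _ ^+ X](card_Fp p_pr) expf_card.
  rewrite p0.
  rewrite !rmorphN rmorph1 ap subrr !mulr0 !add0r -(mulr_natr _ p) p0 mulr0 add0r.
  by rewrite mulrN1 oppr_eq0.
have [u' [v' vE]] := vanish_modp_ideal p_pr va.
exists (u + u' * ('X^p - 'X)), v'.
by rewrite Puv vE !mulrDl expr2 !mulrA addrA [u' * _ * _]mulrAC.
Qed.

Lemma central_identity_ideal (R : nzRingType) (P : {poly int}) :
  noncommutative R -> central_identity R P ->
  exists p : nat, prime p /\ in_ideal2 (p%:R : {poly int}) ('X^p - 'X) P^`().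
Proof.
move=> ncR PC; have [-> | P'0] := eqVneq P^`() 0.
  by exists 2; split=> //; exists 0, 0; rewrite !mul0r addr0.
have [D D0 kill] := central_identity_torsion PC P'0.
have [p [x [y [p_pr xy0 pxy]]]] := prime_torsion_bracket ncR D0 kill.
exists p; split=> //; apply: (vanish_modp_ideal p_pr).
exact: (derivative_vanishes_modp PC D0 kill p_pr xy0 pxy).
Qed.

Theorem theorem4p1 (P : {poly int}) :
  ((exists R : nzRingType, noncommutative R /\ zero_identity R P)
   <-> (exists p : nat, prime p /\
          in_ideal2 (p%:R : {poly int}) (('X^p - 'X) ^+ 2) P))
  /\
  ((exists R : nzRingType, noncommutative R /\ central_identity R P)
   <-> (exists p : nat, prime p /\
          in_ideal2 (p%:R : {poly int}) ('X^p - 'X) P^`())).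
Proof.
split; split=> [[R [ncR]] | [p [p_pr]]].
- exact: zero_identity_ideal.
- exact: zero_identity_example.
- exact: central_identity_ideal.
- exact: central_identity_example.
Qed.
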